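(* Let $W$ be a self-adjoint operator on $\mathcal{H}_{AB}=\mathbb{C}^{d_A}\otimes\mathbb{C}^{d_B}$ which is an entanglement witness, i.e. $\operatorname{Tr}[W\sigma]\ge0$ for all separable states $\sigma\in\mathcal{SEP}(\mathcal{H}_{AB})$, and assume that $W$ is normalised so that $\min_{\sigma\in\mathcal{SEP}(\mathcal{H}_{AB})}\operatorname{Tr}[W\sigma]=0$. If $\|W\|_{\mathrm{Lip}}\le L$ for some $L>0$, then for every state $\rho$ on $\mathcal{H}_{AB}$, $$\mathcal{E}(\rho)\;\ge\;\frac{-\operatorname{Tr}[W\rho]}{L}.$$ In particular, if $\operatorname{Tr}[W\rho]=-\varepsilon<0$, then $\mathcal{E}(\rho)\ge\varepsilon/L$.
   Context: Let $\mathcal{H}_A=\mathbb{C}^{d_A}$, $\mathcal{H}_B=\mathbb{C}^{d_B}$, $\mathcal{H}_{AB}=\mathcal{H}_A\otimes\mathcal{H}_B$. Write $\mathcal{D}(\mathcal{H})$ for the density operators on $\mathcal{H}$, $\mathcal{B}(\mathcal{H})$ for the operators on $\mathcal{H}$, $\|\cdot\|_{op}$ for the operator norm, and $\mathcal{SEP}(\mathcal{H}_{AB})$ for the set of separable states (convex combinations of product states $\sigma_A\otimes\sigma_B$). Fix a family $\{F_i^A\}_{i=1}^{d_A^2-1}$ of traceless Hermitian $d_A\times d_A$ matrices with $\operatorname{Tr}(F_i^AF_j^A)=\delta_{ij}$ and $\|F_i^A\|_{op}\le1$, and similarly a family $\{F_j^B\}_{j=1}^{d_B^2-1}$ for $B$.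 Let $\mathcal{K}_0=\{F_i^A\otimes I_B\}_i\cup\{I_A\otimes F_j^B\}_j$. On two copies $\mathcal{H}_{AB}^{(1)}\otimes\mathcal{H}_{AB}^{(2)}$ of $\mathcal{H}_{AB}$ define the cost operator $$C=\sum_{X\in\mathcal{K}_0}\bigl(X\otimes I_{AB}^{(2)}-I_{AB}^{(1)}\otimes X\bigr)^2 .$$ For $\rho,\sigma\in\mathcal{D}(\mathcal{H}_{AB})$ let $\Pi(\rho,\sigma)$ be the set of density operators on $\mathcal{H}_{AB}^{(1)}\otimes\mathcal{H}_{AB}^{(2)}$ with marginals $\rho$ and $\sigma$. The quantum Wasserstein distance of order 1 is $W_1(\rho,\sigma)=\bigl(\inf_{\tau\in\Pi(\rho,\sigma)}\operatorname{Tr}[C\tau]\bigr)^{1/2}$, and the Wasserstein entanglement measure is $$\mathcal{E}(\rho)=\inf_{\sigma\in\mathcal{SEP}(\mathcal{H}_{AB})}W_1(\rho,\sigma).$$ For self-adjoint $H\in\mathcal{B}(\mathcal{H}_{AB})$ the Lipschitz seminorm is $$\|H\|_{\mathrm{Lip}}=\max\Bigl\{\sup_{A\in\mathcal{B}(\mathcal{H}_A),\,\|A\|_{op}\le1}\|[A\otimes I_B,H]\|_{op},\ \sup_{B\in\mathcal{B}(\mathcal{H}_B),\,\|B\|_{op}\le1}\|[I_A\otimes B,H]\|_{op}\Bigr\}.$$ *)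

(* Defs.v *)
(* Operators on C^n are n x n matrices over R[i], with R : realType, acting on
   column vectors. The tensor product is the Kronecker product [*t], so that
   C^m (x) C^n is C^(m * n) with basis indexed through [mxtens_index]. *)
From HB Require Import structures.
From mathcomp Require Export all_boot all_order all_algebra.
From mathcomp Require Export sesquilinear spectral.
From mathcomp Require Export boolp classical_sets reals.
From mathcomp Require Export complex mxtens.

Set Implicit Arguments.
Unset Strict Implicit.
Unset Printing Implicit Defensive.

Import Order.TTheory GRing.Theory Num.Theory.

Local Open Scope classical_set_scope.
Local Open Scope ring_scope.

Section Operators.
Context {R : realType}.

Definition l2norm n (v : 'cV[R[i]]_n) : R :=
  Num.sqrt (\sum_(i < n) Normc.normc (v i 0) ^+ 2).

Definition opnorm n (A : 'M[R[i]]_n) : R :=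
  sup [set l2norm (A *m v) | v in [set v : 'cV[R[i]]_n | l2norm v <= 1]].

Definition comm n (A B : 'M[R[i]]_n) : 'M[R[i]]_n := A *m B - B *m A.

(* In the order of R[i], [0 <= z] says that z is real and nonnegative. *)
Definition psdmx n (A : 'M[R[i]]_n) : Prop :=
  forall v : 'cV[R[i]]_n, 0 <= ((map_mx Num.conj v)^T *m A *m v) 0 0.

Definition density {n} : set 'M[R[i]]_n :=
  [set rho | [/\ rho \is hermsymmx, psdmx rho & \tr rho = 1]].

(* Tr[H rho]. It is a real number for self-adjoint H and rho, the only case
   in which it is used; taking the real part only casts it into R. *)
Definition expval n (H rho : 'M[R[i]]_n) : R := complex.Re (\tr (H *m rho)).

(* [ptrace1] traces out the first tensor factor, [ptrace2] the second. *)
Definition ptrace1 m n (tau : 'M[R[i]]_(m * n)) : 'M[R[i]]_n :=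
  \matrix_(j, l) \sum_(i < m) tau (mxtens_index (i, j)) (mxtens_index (i, l)).

Definition ptrace2 m n (tau : 'M[R[i]]_(m * n)) : 'M[R[i]]_m :=
  \matrix_(i, k) \sum_(j < n) tau (mxtens_index (i, j)) (mxtens_index (k, j)).

Definition separable {dA dB} : set 'M[R[i]]_(dA * dB) :=
  [set sigma | exists (n : nat) (p : 'I_n -> R)
      (sA : 'I_n -> 'M[R[i]]_dA) (sB : 'I_n -> 'M[R[i]]_dB),
    [/\ forall k, 0 <= p k,
        \sum_(k < n) p k = 1,
        forall k, density (sA k),
        forall k, density (sB k) &
        sigma = \sum_(k < n) (p k)%:C%C *: (sA k *t sB k)]].

Definition traceless_orthonormal d (F : 'I_(d ^ 2 - 1) -> 'M[R[i]]_d) : Prop :=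
  [/\ forall i, F i \is hermsymmx,
      forall i, \tr (F i) = 0,
      forall i j, \tr (F i *m F j) = (i == j)%:R &
      forall i, opnorm (F i) <= 1].

Section Wasserstein.
Variables (dA dB : nat).
Variables (FA : 'I_(dA ^ 2 - 1) -> 'M[R[i]]_dA).
Variables (FB : 'I_(dB ^ 2 - 1) -> 'M[R[i]]_dB).

(* By orthonormality and tracelessness the entries are pairwise distinct, so
   summing over this sequence is summing over the corresponding set. *)
Definition K0 : seq 'M[R[i]]_(dA * dB) :=
  [seq FA i *t (1%:M : 'M_dB) | i <- enum 'I_(dA ^ 2 - 1)] ++
  [seq (1%:M : 'M_dA) *t FB j | j <- enum 'I_(dB ^ 2 - 1)].

Definition cost : 'M[R[i]]_((dA * dB) * (dA * dB)) :=
  \sum_(X <- K0)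
    (X *t (1%:M : 'M_(dA * dB)) - (1%:M : 'M_(dA * dB)) *t X) ^+ 2.

Definition couplings (rho sigma : 'M[R[i]]_(dA * dB)) :
    set 'M[R[i]]_((dA * dB) * (dA * dB)) :=
  [set tau | [/\ density tau, ptrace2 tau = rho & ptrace1 tau = sigma]].

Definition W1 (rho sigma : 'M[R[i]]_(dA * dB)) : R :=
  Num.sqrt (inf [set expval cost tau | tau in couplings rho sigma]).

Definition ent_measure (rho : 'M[R[i]]_(dA * dB)) : R :=
  inf [set W1 rho sigma | sigma in separable].

End Wasserstein.

Definition lipnorm dA dB (H : 'M[R[i]]_(dA * dB)) : R :=
  Num.max
    (sup [set opnorm (comm (A *t (1%:M : 'M_dB)) H)
         | A in [set A : 'M[R[i]]_dA | opnorm A <= 1]])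
    (sup [set opnorm (comm ((1%:M : 'M_dA) *t B) H)
         | B in [set B : 'M[R[i]]_dB | opnorm B <= 1]]).

(* min over separable states of Tr[W sigma] equals 0: lower bound,
   which is the witness condition, and attainment. *)
Definition normalised_witness dA dB (W : 'M[R[i]]_(dA * dB)) : Prop :=
  [/\ W \is hermsymmx,
      forall sigma, separable sigma -> 0 <= expval W sigma &
      exists2 sigma, separable sigma & expval W sigma = 0].

End Operators.

(* Main.v *)
(* Two crude bounds suffice: [- Tr (W rho) <= L] and, when [dA >= 2],
   [1 <= E rho].
   For the first, rho dephased in the basis of the first factor is separable, so
   W has a nonnegative expectation in it. It is also the average of
   [D rho D] over the diagonal sign matrices D on the first factor, and
   [Tr (W rho) - Tr (W D rho D) = Tr (D [D, W] rho)] is at least [- L].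
   For the second, the completeness relation of the matrices F_i^A turns their
   contribution to the cost into [2 dA - 2 S], where S swaps the A factors of the
   two copies. As S <= 1, every coupling costs at least [2 (dA - 1)].
   When [dA = 1] every state is separable and [Tr (W rho) >= 0]. *)
Require Import Defs.
From mathcomp Require Import perm ring lra.
Import Order.TTheory GRing.Theory Num.Theory.
Local Open Scope ring_scope.

Set Implicit Arguments.
Unset Strict Implicit.
Unset Printing Implicit Defensive.

(** * Adjoints, positivity and densities *)

Section Adjoint.
Context {C : numClosedFieldType}.

Definition adjmx {m n} (A : 'M[C]_(m, n)) : 'M[C]_(n, m) := (map_mx Num.conj A)^T.

Lemma adjmxE m n (A : 'M[C]_(m, n)) i j : adjmx A i j = (A j i)^*.
Proof. by rewrite !mxE. Qed.

Lemma adjmxK m n (A : 'M[C]_(m, n)) : adjmx (adjmx A) = A.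
Proof. by apply/matrixP => i j; rewrite !adjmxE conjCK. Qed.

Lemma adjmxM m n p (A : 'M[C]_(m, n)) (B : 'M[C]_(n, p)) :
  adjmx (A *m B) = adjmx B *m adjmx A.
Proof. by rewrite /adjmx map_mxM trmx_mul. Qed.

Lemma adjmxD m n (A B : 'M[C]_(m, n)) : adjmx (A + B) = adjmx A + adjmx B.
Proof. by rewrite /adjmx map_mxD linearD. Qed.

Lemma adjmxN m n (A : 'M[C]_(m, n)) : adjmx (- A) = - adjmx A.
Proof. by rewrite /adjmx map_mxN linearN. Qed.

Lemma adjmx_tens m n p q (A : 'M[C]_(m, n)) (B : 'M[C]_(p, q)) :
  adjmx (A *t B) = adjmx A *t adjmx B.
Proof. by rewrite /adjmx map_mxT trmx_tens. Qed.

Lemma adjmx1 n : adjmx (1%:M : 'M[C]_n) = 1%:M.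
Proof. by rewrite /adjmx map_mx1 trmx1. Qed.

Lemma mxtrace_adj n (A : 'M[C]_n) : \tr (adjmx A) = (\tr A)^*.
Proof. by rewrite rmorph_sum; apply: eq_bigr => i _; rewrite adjmxE. Qed.

Lemma adjmxZ m n c (A : 'M[C]_(m, n)) : adjmx (c *: A) = c^* *: adjmx A.
Proof. by rewrite /adjmx map_mxZ linearZ. Qed.

(** The squared Hilbert-Schmidt norm of [c X + Y]; the two cross terms are conjugate to each
    other. *)
Lemma trace_adj_sqrD m n c (X Y : 'M[C]_(m, n)) :
  \tr (adjmx (c *: X + Y) *m (c *: X + Y)) =
    c^* * c * \tr (adjmx X *m X) +
    (c^* * \tr (adjmx X *m Y) + c * (\tr (adjmx X *m Y))^*) +
    \tr (adjmx Y *m Y).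
Proof.
rewrite -mxtrace_adj adjmxM adjmxK adjmxD adjmxZ mulmxDl !mulmxDr.
by rewrite -!scalemxAl -!scalemxAr !linearD /= !mxtraceZ; ring.
Qed.

Lemma hermsymmxP n (A : 'M[C]_n) : A \is hermsymmx <-> adjmx A = A.
Proof.
have -> : (A \is hermsymmx) = (A == adjmx A).
  by rewrite is_hermitianmxE expr0 scale1r /adjmx map_trmx.
by split => [/eqP <- | ->].
Qed.

Lemma mxtrace_tens m n (A : 'M[C]_m) (B : 'M[C]_n) : \tr (A *t B) = \tr A * \tr B.
Proof. by rewrite /mxtrace mulr_sum; apply: eq_bigr => i _; rewrite mxE. Qed.

(** By the spectral theorem [A = U^* D U] with [D] diagonal and nonnegative, so that
    [B = U^* sqrt D] works. *)
Lemma nonneg_form_gram n (A : 'M[C]_n) : A \is hermsymmx -> 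
  (forall v : 'cV_n, 0 <= (adjmx v *m A *m v) 0 0) ->
  exists B : 'M[C]_n, A = B *m adjmx B.
Proof.
move=> hA pA.
have [U [d [uU eA]]] : exists (U : 'M[C]_n) (d : 'rV[C]_n),
    U \is unitarymx /\ A = invmx U *m diag_mx d *m U.
  exists (spectralmx A), (spectral_diag A); split; first exact: spectral_unitarymx.
  by apply/orthomx_spectralP; apply: hermitian_normalmx.
have iU : invmx U = adjmx U by rewrite invmx_unitary // /adjmx map_trmx.
have U1 : U *m adjmx U = 1%:M by rewrite -iU mulmxV // unitarymx_unit.
have ed : diag_mx d = U *m A *m adjmx U.
  by rewrite eA iU !mulmxA U1 mul1mx -mulmxA U1 mulmx1.
(* The eigenvalue [d 0 i] is the value of the form at the eigenvector [U^* e_i]. *)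
have d0 i : 0 <= d 0 i.
  have -> : d 0 i = diag_mx d i i by rewrite mxE eqxx.
  have := pA (adjmx U *m delta_mx i 0).
  rewrite adjmxM adjmxK !mulmxA -(mulmxA _ U) -(mulmxA _ (U *m A)) -ed.
  have -> : adjmx (delta_mx i 0 : 'cV[C]_n) = delta_mx 0 i.
    by rewrite /adjmx map_delta_mx trmx_delta.
  by rewrite -rowE -colE !mxE.
set S := diag_mx (\row_i sqrtC (d 0 i)).
have hS : adjmx S = S.
  apply/matrixP => i j; rewrite adjmxE !mxE eq_sym.
  case: eqVneq => [->|]; rewrite ?mulr1n ?mulr0n ?conjC0 //.
  by rewrite conj_Creal // ger0_real // sqrtC_ge0.
have SS : S *m S = diag_mx d.
  rewrite mulmx_diag; congr diag_mx; apply/rowP => i.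
  by rewrite !mxE -expr2 sqrtCK.
exists (adjmx U *m S).
by rewrite eA iU -SS adjmxM adjmxK hS !mulmxA.
Qed.

End Adjoint.

Section Positive.
Context {R : realType}.
Local Notation C := R[i].

Lemma gram_psd m n (B : 'M[C]_(m, n)) : psdmx (B *m adjmx B).
Proof.
move=> v; rewrite -/(adjmx v).
have -> : adjmx v *m (B *m adjmx B) *m v = adjmx (adjmx B *m v) *m (adjmx B *m v).
  by rewrite adjmxM adjmxK !mulmxA.
rewrite mxE sumr_ge0 // => i _.
by rewrite adjmxE mulrC mul_conjC_ge0.
Qed.

Lemma psd_conj m n (A : 'M[C]_m) (B : 'M[C]_(m, n)) :
  psdmx A -> psdmx (adjmx B *m A *m B).
Proof.
move=> hA v; rewrite -/(adjmx v).
have := hA (B *m v); rewrite -/(adjmx _) adjmxM.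
by rewrite !mulmxA.
Qed.

Lemma psd_diag n (A : 'M[C]_n) i : psdmx A -> 0 <= A i i.
Proof.
move=> /(_ (delta_mx i 0)); rewrite -/(adjmx _).
have -> : adjmx (delta_mx i 0 : 'cV[C]_n) = delta_mx 0 i.
  by rewrite /adjmx map_delta_mx trmx_delta.
by rewrite -rowE -colE !mxE.
Qed.

Lemma psd_trace n (A : 'M[C]_n) : psdmx A -> 0 <= \tr A.
Proof. by move=> hA; apply: sumr_ge0 => i _; apply: psd_diag. Qed.

Lemma psd_gram n (A : 'M[C]_n) : A \is hermsymmx -> psdmx A ->
  exists B : 'M[C]_n, A = B *m adjmx B.
Proof. exact: nonneg_form_gram. Qed.

Lemma density_gram n m (B : 'M[C]_(n, m)) :
  \tr (B *m adjmx B) = 1 -> density (B *m adjmx B).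
Proof.
move=> h; split=> //; last exact: gram_psd.
by apply/hermsymmxP; rewrite adjmxM adjmxK.
Qed.

(** The working form of a density: expectations in [B B^*] become Hilbert-Schmidt inner products
    involving [B]. *)
Lemma densityP n (rho : 'M[C]_n) :
  density rho <-> (exists B : 'M[C]_n, rho = B *m adjmx B) /\ \tr rho = 1.
Proof.
split=> [[h p t]|[[B ->] t]]; last exact: density_gram.
by split=> //; apply: psd_gram.
Qed.

(** The trace is the sum of the squared moduli of the entries of [B]. *)
Lemma gram_eq0 m n (B : 'M[C]_(m, n)) : \tr (B *m adjmx B) = 0 -> B = 0.
Proof.
rewrite /mxtrace; move=> /eqP; rewrite psumr_eq0; last first.
  by move=> i _; apply: psd_diag; apply: gram_psd.
move=> /allP h; apply/matrixP => i j; rewrite [RHS]mxE.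
have := h i; rewrite mem_index_enum => /(_ isT) /=.
rewrite mxE psumr_eq0 => [/allP /(_ j)|k _]; last by rewrite adjmxE mul_conjC_ge0.
by rewrite mem_index_enum adjmxE mul_conjC_eq0 => /(_ isT) /eqP.
Qed.

Lemma density_tens m n (rho : 'M[C]_m) (sigma : 'M[C]_n) :
  density rho -> density sigma -> density (rho *t sigma).
Proof.
move=> /densityP [[A ->] tA] /densityP [[B ->] tB].
rewrite -tensmx_mul -adjmx_tens; apply: density_gram.
by rewrite adjmx_tens tensmx_mul mxtrace_tens tA tB mulr1.
Qed.

Lemma density_delta n (i : 'I_n) : density (delta_mx i i : 'M[C]_n).
Proof.
have e : delta_mx i i = (delta_mx i 0 : 'cV[C]_n) *m adjmx (delta_mx i 0 : 'cV[C]_n).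
  by rewrite /adjmx map_delta_mx trmx_delta mul_delta_mx.
rewrite e; apply: density_gram; rewrite -e /mxtrace (bigD1 i) //= big1 ?addr0.
  by rewrite mxE !eqxx.
by move=> j ji; rewrite mxE (negbTE ji).
Qed.

Lemma conj_real_complex (x : R) : 0 <= x -> Num.conj (x%:C%C) = x%:C%C.
Proof.
move=> x0; by apply/conj_Creal/ger0_real; rewrite ler0c.
Qed.

Lemma density_convex n k (p : 'I_k -> R) (s : 'I_k -> 'M[C]_n) :
  (forall i, 0 <= p i) -> \sum_i p i = 1 -> (forall i, density (s i)) ->
  density (\sum_i (p i)%:C%C *: s i).
Proof.
move=> p0 p1 hs; split.
- apply/hermsymmxP/matrixP => a b; rewrite adjmxE !summxE rmorph_sum /=.
  apply: eq_bigr => i _; have [/hermsymmxP/matrixP/(_ a b) h _ _] := hs i.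
  rewrite !mxE rmorphM -h adjmxE.
  by congr (_ * _); apply: conj_real_complex.
- move=> v; rewrite mulmx_sumr mulmx_suml summxE sumr_ge0 // => i _.
  rewrite -scalemxAr -scalemxAl mxE mulr_ge0 ?ler0c //.
  by have [_ + _] := hs i; apply.
- rewrite linear_sum /= -[RHS]/((1 : R)%:C)%C -p1 rmorph_sum /=.
  by apply: eq_bigr => i _; rewrite mxtraceZ; have [_ _ ->] := hs i; rewrite mulr1.
Qed.

Lemma separable_density dA dB (sigma : 'M[C]_(dA * dB)) :
  separable sigma -> density sigma.
Proof.
move=> [n [p [sA [sB [p0 p1 hA hB ->]]]]].
by apply: density_convex => // k; apply: density_tens.
Qed.

(** The product coupling shows that the infimum in [W1] is over a nonempty set. *)
Lemma couplings_tens dA dB (rho sigma : 'M[C]_(dA * dB)) :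
  density rho -> density sigma -> couplings rho sigma (rho *t sigma).
Proof.
move=> hr hs; split; first exact: density_tens.
- apply/matrixP => i k; rewrite mxE; have [_ _ h] := hs.
  under eq_bigr do rewrite tensmxE.
  by rewrite -mulr_sumr -/(\tr sigma) h mulr1.
- apply/matrixP => i k; rewrite mxE; have [_ _ h] := hr.
  under eq_bigr do rewrite tensmxE.
  by rewrite -mulr_suml -/(\tr rho) h mul1r.
Qed.

Lemma Re_ge0 (z : C) : 0 <= z -> 0 <= complex.Re z.
Proof. by rewrite lecE => /andP []. Qed.

(** By cyclicity the trace equals that of [X^* tau X], which is positive. *)
Lemma expval_sqr_ge0 n (X tau : 'M[C]_n) :
  adjmx X = X -> psdmx tau -> 0 <= expval (X *m X) tau.
Proof.
move=> hX ht; apply: Re_ge0; rewrite -mulmxA mxtrace_mulC -[Y in Y *m _ *m _]hX.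
exact/psd_trace/psd_conj.
Qed.

End Positive.

(** * Kronecker products of sums and of scalar matrices *)

Section TensLinear.
Context {K : comPzRingType}.
Variables m n p q : nat.

Lemma tensmx_suml (I : finType) (F : I -> 'M[K]_(m, n)) (B : 'M[K]_(p, q)) :
  (\sum_i F i) *t B = \sum_i F i *t B.
Proof.
apply/matrixP => i j; rewrite mxE !summxE mulr_suml.
by apply: eq_bigr => k _; rewrite mxE.
Qed.

Lemma tensmx_sumr (I : finType) (A : 'M[K]_(m, n)) (F : I -> 'M[K]_(p, q)) :
  A *t (\sum_i F i) = \sum_i A *t F i.
Proof.
apply/matrixP => i j; rewrite mxE !summxE mulr_sumr.
by apply: eq_bigr => k _; rewrite mxE.
Qed.

Lemma tensmx_scalar (c : K) : (c%:M : 'M_m) *t (1%:M : 'M_n) = c%:M.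
Proof.
apply/matrixP => x y; case: (mxtens_indexP x) => i a; case: (mxtens_indexP y) => k b.
rewrite tensmxE !mxE (inj_eq (can_inj (@mxtens_indexK _ _))) xpair_eqE.
by case: (i == k); case: (a == b); rewrite ?(mulr0n, mulr1n, mulr0, mulr1, mul0r).
Qed.

Lemma tensmx_scalar_r (c : K) : (1%:M : 'M_m) *t (c%:M : 'M_n) = c%:M.
Proof.
apply/matrixP => x y; case: (mxtens_indexP x) => i a; case: (mxtens_indexP y) => k b.
rewrite tensmxE !mxE (inj_eq (can_inj (@mxtens_indexK _ _))) xpair_eqE.
by case: (i == k); case: (a == b); rewrite ?(mulr0n, mulr1n, mulr0, mulr1, mul0r, mul1r).
Qed.
End TensLinear.

(** * Operator norms *)

Section Norms.
Context {R : realType}.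
Local Notation C := R[i].
Local Notation normc := Normc.normc.

Lemma normc_ge0 (x : C) : 0 <= normc x.
Proof. by case: x => a b; apply: sqrtr_ge0. Qed.

Lemma sqr_normc (x : C) : ((normc x ^+ 2)%:C)%C = x^* * x.
Proof. by rewrite rmorphXn /= mulrC -normCK. Qed.

Lemma l2norm_ge0 n (v : 'cV[C]_n) : 0 <= l2norm v.
Proof. exact: sqrtr_ge0. Qed.

Lemma l2norm_sqr n (v : 'cV[C]_n) : ((l2norm v ^+ 2)%:C)%C = \tr (adjmx v *m v).
Proof.
rewrite sqr_sqrtr; last by apply: sumr_ge0 => i _; apply: sqr_ge0.
rewrite trace_mx11 mxE rmorph_sum; apply: eq_bigr => i _.
by apply: etrans (sqr_normc _) _; rewrite adjmxE.
Qed.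

Lemma l2norm0 n : l2norm (0 : 'cV[C]_n) = 0.
Proof.
rewrite /l2norm big1 ?sqrtr0 // => i _.
by rewrite mxE Normc.normc0 expr0n.
Qed.

Lemma l2normZ n (a : C) (v : 'cV[C]_n) : l2norm (a *: v) = normc a * l2norm v.
Proof.
rewrite /l2norm -[in RHS](ger0_norm (normc_ge0 a)) -sqrtr_sqr -sqrtrM ?sqr_ge0 //.
rewrite mulr_sumr; congr Num.sqrt; apply: eq_bigr => i _.
by rewrite mxE Normc.normcM exprMn.
Qed.

Lemma l2norm_eq0 n (v : 'cV[C]_n) : l2norm v = 0 -> v = 0.
Proof.
move=> v0; have := l2norm_sqr v; rewrite v0 expr0n /= => /esym.
rewrite mxtrace_mulC => h; apply: gram_eq0; exact: h.
Qed.

Lemma normc_le_l2norm n (v : 'cV[C]_n) i : normc (v i 0) <= l2norm v.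
Proof.
rewrite -[leLHS](ger0_norm (normc_ge0 _)) -sqrtr_sqr; apply: ler_wsqrtr.
by rewrite (bigD1 i) //= lerDl sumr_ge0 // => j _; apply: sqr_ge0.
Qed.

Lemma l2norm_le_sum n (v : 'cV[C]_n) : l2norm v <= \sum_i normc (v i 0).
Proof.
have s0 : 0 <= \sum_i normc (v i 0) by apply: sumr_ge0 => i _; apply: normc_ge0.
rewrite -[leRHS](ger0_norm s0) -sqrtr_sqr; apply: ler_wsqrtr.
rewrite expr2 mulr_suml; apply: ler_sum => i _.
rewrite expr2 ler_wpM2l ?normc_ge0 // (bigD1 i) //= lerDl.
by apply: sumr_ge0 => j _; apply: normc_ge0.
Qed.

Lemma normc_sum_le (I : finType) (F : I -> C) : normc (\sum_i F i) <= \sum_i normc (F i).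
Proof.
elim/big_ind2: _ => [|x a y b xa yb|//].
  by rewrite Normc.normc0.
exact: le_trans (complex.le_normcD _ _) (lerD xa yb).
Qed.

(** A crude submultiplicative norm. It serves to show that the sets whose suprema define [opnorm]
    and [lipnorm] are bounded above. *)
Definition entry_norm {m n} (A : 'M[C]_(m, n)) : R := \sum_i \sum_j normc (A i j).

Lemma entry_norm_ge0 m n (A : 'M[C]_(m, n)) : 0 <= entry_norm A.
Proof. by apply: sumr_ge0 => i _; apply: sumr_ge0 => j _; apply: normc_ge0. Qed.

Lemma entry_normD m n (A B : 'M[C]_(m, n)) :
  entry_norm (A + B) <= entry_norm A + entry_norm B.
Proof.
rewrite -big_split; apply: ler_sum => i _; rewrite -big_split.
by apply: ler_sum => j _; rewrite mxE; apply: complex.le_normcD.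
Qed.

Lemma entry_normN m n (A : 'M[C]_(m, n)) : entry_norm (- A) = entry_norm A.
Proof.
by apply: eq_bigr => i _; apply: eq_bigr => j _; rewrite mxE complex.normcN.
Qed.

Lemma entry_norm_mul m n p (A : 'M[C]_(m, n)) (B : 'M[C]_(n, p)) :
  entry_norm (A *m B) <= entry_norm A * entry_norm B.
Proof.
rewrite mulr_suml; apply: ler_sum => i _.
rewrite mulr_suml.
apply: (@le_trans _ _ (\sum_j \sum_k normc (A i k) * normc (B k j))).
  apply: ler_sum => j _; rewrite mxE; apply: le_trans (normc_sum_le _) _.
  by apply: ler_sum => k _; rewrite Normc.normcM.
rewrite exchange_big; apply: ler_sum => k _; rewrite -mulr_sumr.
rewrite ler_wpM2l ?normc_ge0 // [leRHS](bigD1 k) //= lerDl.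
by apply: sumr_ge0 => l _; apply: sumr_ge0 => j _; apply: normc_ge0.
Qed.

Lemma entry_norm_comm n (A B : 'M[C]_n) :
  entry_norm (comm A B) <= 2 * entry_norm A * entry_norm B.
Proof.
apply: le_trans (entry_normD _ _) _; rewrite entry_normN.
have := entry_norm_mul A B; have := entry_norm_mul B A; lra.
Qed.

Lemma l2norm_mul_le_entry m n (A : 'M[C]_(m, n)) (v : 'cV[C]_n) :
  l2norm v <= 1 -> l2norm (A *m v) <= entry_norm A.
Proof.
move=> v1; apply: le_trans (l2norm_le_sum _) _; apply: ler_sum => i _.
rewrite mxE; apply: le_trans (normc_sum_le _) _; apply: ler_sum => j _.
rewrite Normc.normcM ler_piMr ?normc_ge0 //.
exact: le_trans (normc_le_l2norm _ _) v1.
Qed.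

Lemma opnorm_ub n (A : 'M[C]_n) (v : 'cV[C]_n) :
  l2norm v <= 1 -> l2norm (A *m v) <= opnorm A.
Proof.
move=> v1; apply: ub_le_sup; last by exists v.
by exists (entry_norm A) => _ [w w1 <-]; apply: l2norm_mul_le_entry.
Qed.

Lemma opnorm_le n (A : 'M[C]_n) c :
  (forall v, l2norm v <= 1 -> l2norm (A *m v) <= c) -> opnorm A <= c.
Proof.
move=> h; apply: ge_sup; last by move=> _ [v v1 <-]; apply: h.
by exists (l2norm (A *m (0 : 'cV[C]_n))), 0 => //=; rewrite l2norm0 ler01.
Qed.

(** Rescale [v] to a unit vector; the zero vector is treated apart. *)
Lemma l2norm_mul_le n (A : 'M[C]_n) (v : 'cV[C]_n) :
  l2norm (A *m v) <= opnorm A * l2norm v.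
Proof.
have [v0|v0] := eqVneq (l2norm v) 0.
  by rewrite v0 mulr0 (l2norm_eq0 v0) mulmx0 l2norm0.
have vp : 0 < l2norm v by rewrite lt_neqAle eq_sym v0 l2norm_ge0.
have nI : normc ((l2norm v)^-1%:C)%C = (l2norm v)^-1.
  by rewrite /= expr0n addr0 sqrtr_sqr ger0_norm // invr_ge0 l2norm_ge0.
have := @opnorm_ub _ A (((l2norm v)^-1%:C)%C *: v).
rewrite -scalemxAr !l2normZ nI mulVf // => /(_ (lexx _)).
by rewrite mulrC ler_pdivrMr.
Qed.

Lemma entry_le_opnorm n (A : 'M[C]_n) i j : normc (A i j) <= opnorm A.
Proof.
have -> : A i j = (A *m delta_mx j 0 : 'cV_n) i 0 by rewrite -colE mxE.
apply: le_trans (normc_le_l2norm _ _) _; apply: opnorm_ub.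
rewrite /l2norm (bigD1 j) //= big1 ?addr0 => [|k kj].
  by rewrite mxE !eqxx mulr1n Normc.normc1 expr1n sqrtr1.
by rewrite mxE (negbTE kj) Normc.normc0 expr0n.
Qed.

(** Each of the [(m n)^2] entries is zero or an entry of [A], hence of modulus at most 1. The bound
    is uniform over the unit ball. *)
Lemma entry_norm_tens1 m n (A : 'M[C]_m) :
  opnorm A <= 1 -> entry_norm (A *t (1%:M : 'M[C]_n)) <= ((m * n) ^ 2)%:R.
Proof.
move=> A1; apply: (@le_trans _ _ (\sum_(i < m * n) \sum_(j < m * n) (1 : R))).
  apply: ler_sum => i _; apply: ler_sum => j _; rewrite mxE.
  rewrite Normc.normcM mxE.
  have := le_trans (entry_le_opnorm A (mxtens_unindex i).1 (mxtens_unindex j).1) A1.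
  case: (_ == _); rewrite ?mulr1n ?Normc.normc1 ?mulr1 //.
  by rewrite Normc.normc0 mulr0 ler01.
by rewrite !sumr_const card_ord -mulrnA mulnn.
Qed.

(** The commutator is a member of the first family in [lipnorm]; what has to be checked is that this
    family is bounded. *)
Lemma opnorm_comm_le_lipnorm m n (A : 'M[C]_m) (H : 'M[C]_(m * n)) :
  opnorm A <= 1 -> opnorm (comm (A *t 1%:M) H) <= lipnorm H.
Proof.
move=> A1; rewrite le_max; apply/orP; left; apply: ub_le_sup; last by exists A.
exists (2 * ((m * n) ^ 2)%:R * entry_norm H) => _ [B B1 <-].
apply: opnorm_le => v v1; apply: le_trans (l2norm_mul_le_entry _ v1) _.
apply: le_trans (entry_norm_comm _ _) _.
by rewrite ler_wpM2r ?entry_norm_ge0 // ler_wpM2l // entry_norm_tens1.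
Qed.

Lemma opnorm_isometry n (U : 'M[C]_n) : adjmx U *m U = 1%:M -> opnorm U <= 1.
Proof.
move=> hU; apply: opnorm_le => v v1.
suff -> : l2norm (U *m v) = l2norm v by [].
apply/eqP; rewrite -(@eqrXn2 _ 2) ?l2norm_ge0 //; apply/eqP/complexI.
by rewrite !l2norm_sqr adjmxM -mulmxA (mulmxA _ U) hU mul1mx.
Qed.

(** The squared Hilbert-Schmidt norm is the sum of the squared norms of the columns, and [K] acts on
    each column separately. *)
Lemma trace_adj_mul_le n p (K : 'M[C]_n) (B : 'M[C]_(n, p)) L :
  opnorm K <= L ->
  \tr (adjmx (K *m B) *m (K *m B)) <= (L ^+ 2)%:C%C * \tr (adjmx B *m B).
Proof.
move=> KL; have colT q (M : 'M[C]_(q, p)) :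
    \tr (adjmx M *m M) = ((\sum_j l2norm (col j M) ^+ 2)%:C)%C.
  rewrite rmorph_sum; apply: eq_bigr => j _; rewrite /= l2norm_sqr trace_mx11.
  by rewrite !mxE; apply: eq_bigr => i _; rewrite !mxE.
rewrite !colT -rmorphM lecR mulr_sumr; apply: ler_sum => j _.
rewrite -exprMn ler_sqr ?nnegrE ?l2norm_ge0 //.
  rewrite colE -mulmxA -colE; apply: le_trans (l2norm_mul_le _ _) _.
  by rewrite ler_wpM2r ?l2norm_ge0.
(* Nonnegativity of [L] follows from [0 <= |K 0| <= opnorm K <= L]. *)
rewrite mulr_ge0 ?l2norm_ge0 //; apply: le_trans KL.
apply: le_trans (l2norm_ge0 (K *m (0 : 'cV_n))) _; apply: opnorm_ub.
by rewrite l2norm0 ler01.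
Qed.

(* [0 <= |L U v + K v|^2] with [|U v| = |v|] and [|K v| <= L |v|] bounds
   [2 L Re <U v, K v>] from below without the Cauchy-Schwarz inequality. *)
Lemma expval_conj_unitary n (U W rho : 'M[C]_n) (L : R) :
  0 < L -> adjmx U = U -> U *m U = 1%:M -> opnorm (comm U W) <= L ->
  density rho -> expval W (U *m rho *m U) - L <= expval W rho.
Proof.
move=> L0 hU U2 KL /densityP [[B ->] tB].
set K := comm U W in KL *.
have UK : U *m K = W - U *m W *m U.
  by rewrite /K /comm mulmxBr !mulmxA U2 mul1mx.
(* The inner product of [U B] and [K B]; since [U K = W - U W U], its real part is the difference of
   the two expectations. *)
set z : C := \tr (adjmx B *m U *m K *m B).
have ez : expval W (B *m adjmx B) - expval W (U *m (B *m adjmx B) *m U) = complex.Re z.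
  rewrite /expval -raddfB; congr complex.Re.
  rewrite /z -(mulmxA _ U) UK mulmxBr mulmxBl linearB /=.
  congr (_ - _); first by rewrite mulmxA mxtrace_mulC !mulmxA.
  by rewrite !mulmxA mxtrace_mulC !mulmxA mxtrace_mulC !mulmxA mxtrace_mulC !mulmxA.
suff : - L <= complex.Re z by rewrite -ez; lra.
have tB' : \tr (adjmx B *m B) = 1 by rewrite mxtrace_mulC.
have hK := trace_adj_mul_le B KL; rewrite tB' mulr1 in hK.
have : 0 <= \tr (adjmx ((L%:C)%C *: (U *m B) + K *m B) *m ((L%:C)%C *: (U *m B) + K *m B)).
  by rewrite mxtrace_mulC; apply/psd_trace/gram_psd.
rewrite trace_adj_sqrD.
have -> : \tr (adjmx (U *m B) *m (U *m B)) = 1.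
  by rewrite adjmxM hU -mulmxA (mulmxA U) U2 mul1mx.
have -> : \tr (adjmx (U *m B) *m (K *m B)) = z by rewrite adjmxM hU !mulmxA.
rewrite (conj_real_complex (ltW L0)) mulr1 -mulrDr => h.
have {h} := le_trans h (lerD (lexx _) hK).
move: {ez} z => [x y]; rewrite lecE => /andP [_] /=.
(* With [x] the real part of [z], this is [0 <= L^2 + 2 L x + L^2], to be divided by [2 L]. *)
nra.
Qed.
End Norms.

(** * Dephasing *)

Section Dephasing.
Context {R : realType}.
Variables dA dB : nat.
Local Notation C := R[i].

Definition diag_block (k : 'I_dA) (rho : 'M[C]_(dA * dB)) : 'M[C]_dB :=
  \matrix_(a, b) rho (mxtens_index (k, a)) (mxtens_index (k, b)).

(** The block-diagonal part of [rho], written as a sum of Kronecker products so that separability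
    can be read off. *)
Definition dephase (rho : 'M[C]_(dA * dB)) : 'M[C]_(dA * dB) :=
  \sum_k delta_mx k k *t diag_block k rho.

Lemma dephaseE rho i a k b :
  dephase rho (mxtens_index (i, a)) (mxtens_index (k, b)) =
  (i == k)%:R * rho (mxtens_index (i, a)) (mxtens_index (k, b)).
Proof.
rewrite summxE (bigD1 i) //= big1 => [|j ji]; rewrite tensmxE !mxE.
  by rewrite eqxx addr0 [k == i]eq_sym; case: eqVneq => [->|_]; rewrite ?mul0r.
by rewrite [i == j]eq_sym (negbTE ji) mul0r.
Qed.

Lemma diag_block_gram rho : density rho -> forall k,
  exists B : 'M[C]_(dB, dA * dB), diag_block k rho = B *m adjmx B.
Proof.
move=> /densityP [[B ->] _] k.
exists (\matrix_(a, j) B (mxtens_index (k, a)) j).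
by apply/matrixP => a b; rewrite !mxE; apply: eq_bigr => j _; rewrite !mxE.
Qed.

Lemma sum_trace_diag_block rho : \sum_k \tr (diag_block k rho) = \tr rho.
Proof.
rewrite /mxtrace pair_bigA /= [RHS](reindex (@mxtens_index dA dB)) /=.
  by apply: eq_bigr => -[k a] _; rewrite mxE.
by exists (@mxtens_unindex dA dB) => i _; rewrite ?mxtens_indexK ?mxtens_unindexK.
Qed.

Lemma density_gt0 n (rho : 'M[C]_n) : density rho -> (0 < n)%N.
Proof.
case: n rho => // rho [_ _ /eqP]; rewrite /mxtrace big_ord0 eq_sym.
by rewrite oner_eq0.
Qed.

(** The weights are the traces of the diagonal blocks, and the states on the second factor are the
    normalised blocks. *)
Lemma dephase_separable rho : density rho -> separable (dephase rho).
Proof.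
move=> hrho; have := density_gt0 hrho; rewrite muln_gt0 => /andP [_ dB0].
have hB := diag_block_gram hrho.
have tr_ge0 k : 0 <= \tr (diag_block k rho).
  by have [B ->] := hB k; apply/psd_trace/gram_psd.
pose p k := complex.Re (\tr (diag_block k rho)).
have pE k : (p k)%:C%C = \tr (diag_block k rho) by rewrite RRe_real ?ger0_real.
(* A block of trace zero cannot be normalised; an arbitrary basis state, which exists because
   [dB > 0], takes its place with weight zero. *)
exists dA, p, (fun k => delta_mx k k),
  (fun k => if p k == 0 then delta_mx (Ordinal dB0) (Ordinal dB0)
            else ((p k)^-1)%:C%C *: diag_block k rho); split.
- by move=> k; apply: Re_ge0.
- apply: complexI; rewrite rmorph_sum /=; under eq_bigr do rewrite pE.
  by rewrite sum_trace_diag_block; case: hrho.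
- by move=> k; apply: density_delta.
- move=> k; case: eqVneq => [_|pk]; first exact: density_delta.
  have [B eB] := hB k.
  have ip : 0 <= (p k)^-1 by rewrite invr_ge0; apply: Re_ge0.
  have e : ((p k)^-1)%:C%C *: diag_block k rho =
      ((Num.sqrt (p k)^-1)%:C%C *: B) *m adjmx ((Num.sqrt (p k)^-1)%:C%C *: B).
    rewrite adjmxZ conj_real_complex ?sqrtr_ge0 // -scalemxAl -scalemxAr scalerA.
    rewrite -eB; congr (_ *: _).
    by rewrite -rmorphM /= -expr2 sqr_sqrtr.
  rewrite e; apply: density_gram; rewrite -e mxtraceZ -pE -rmorphM mulVf //.
- apply: eq_bigr => k _; case: eqVneq => [pk|pk].
    (* A positive block of trace zero vanishes, so the placeholder state does no harm. *)
    have [B eB] := hB k; have := pE k; rewrite pk eB => /esym h.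
    rewrite (gram_eq0 h) mul0mx tensmx0 scale0r //.
  apply/matrixP => i j; rewrite !mxE mulrCA; congr (_ * _).
  by rewrite mulrA -rmorphM mulfV // mul1r.
Qed.

Definition sign_mx (s : {ffun 'I_dA -> bool}) : 'M[C]_dA :=
  diag_mx (\row_i (-1) ^+ s i).

Lemma sign_mx_adj s : adjmx (sign_mx s) = sign_mx s.
Proof.
apply/matrixP => i j; rewrite adjmxE !mxE eq_sym.
by case: eqVneq => [->|_]; rewrite ?mulr1n ?mulr0n ?conjC0 // rmorph_sign.
Qed.

Lemma sign_mx_sqr s : sign_mx s *m sign_mx s = 1%:M.
Proof.
rewrite mulmx_diag -[RHS]diag_const_mx; congr diag_mx; apply/rowP => i.
by rewrite !mxE -expr2 sqrr_sign.
Qed.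

Lemma sign_conjE s (rho : 'M[C]_(dA * dB)) i a k b :
  ((sign_mx s *t 1%:M) *m rho *m (sign_mx s *t 1%:M))
    (mxtens_index (i, a)) (mxtens_index (k, b)) =
  (-1) ^+ s i * (-1) ^+ s k * rho (mxtens_index (i, a)) (mxtens_index (k, b)).
Proof.
have -> : sign_mx s *t 1%:M =
    diag_mx (\row_j (-1) ^+ s (@mxtens_unindex dA dB j).1) :> 'M[C]_(dA * dB).
  apply/matrixP => x y; case: (mxtens_indexP x) => {}i {}a; case: (mxtens_indexP y) => {}k {}b.
  rewrite tensmxE !mxE mxtens_indexK (inj_eq (can_inj (@mxtens_indexK _ _))) xpair_eqE /=.
  by case: (i == k); case: (a == b); rewrite ?(mulr0n, mulr1n, mulr0, mulr1, mul0r).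
by rewrite mul_mx_diag mul_diag_mx !mxE !mxtens_indexK /= mulrAC.
Qed.

(** Orthogonality of random signs: for [i <> k], flipping the sign at [i] is a bijection that
    negates every term, so the sum equals its own opposite. *)
Lemma sum_sign_mul (i k : 'I_dA) :
  \sum_(s : {ffun 'I_dA -> bool}) (-1) ^+ s i * (-1) ^+ s k =
  (i == k)%:R * #|{ffun 'I_dA -> bool}|%:R :> C.
Proof.
case: eqVneq => [->|ik].
  rewrite mul1r -sumr_const; apply: eq_bigr => s _.
  by rewrite -expr2 sqrr_sign.
rewrite mul0r; set S := LHS.
suff : S = - S by move/eqP; rewrite -addr_eq0 -mulr2n mulrn_eq0 => /eqP.
pose flip (s : {ffun 'I_dA -> bool}) := [ffun j => if j == i then ~~ s j else s j].
have flipK : involutive flip.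
  by move=> s; apply/ffunP => j; rewrite !ffunE; case: eqP => // _; rewrite negbK.
rewrite {1}/S (reindex_inj (inv_inj flipK)) /= -sumrN; apply: eq_bigr => s _.
by rewrite !ffunE eqxx [k == i]eq_sym (negbTE ik) -mulNr; case: (s i); rewrite ?expr0 ?expr1 ?opprK.
Qed.

Lemma sum_sign_conj (rho : 'M[C]_(dA * dB)) :
  \sum_s (sign_mx s *t 1%:M) *m rho *m (sign_mx s *t 1%:M) =
  #|{ffun 'I_dA -> bool}|%:R *: dephase rho.
Proof.
apply/matrixP => x y; case: (mxtens_indexP x) => i a; case: (mxtens_indexP y) => k b.
rewrite summxE mxE dephaseE; under eq_bigr do rewrite sign_conjE.
by rewrite -mulr_suml sum_sign_mul mulrA; congr (_ * _); rewrite mulrC.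
Qed.

Lemma expval_sumr n (I : finType) (W : 'M[C]_n) (F : I -> 'M[C]_n) :
  expval W (\sum_i F i) = \sum_i expval W (F i).
Proof. by rewrite /expval mulmx_sumr (raddf_sum mxtrace) raddf_sum. Qed.

Lemma expvalMn n (W rho : 'M[C]_n) k : expval W (rho *+ k) = expval W rho *+ k.
Proof.
by rewrite /expval -scaler_nat -scalemxAr mxtraceZ mulr_natl (raddfMn (@complex.Re R)).
Qed.

Lemma expval_ge_opp_lip (W rho : 'M[C]_(dA * dB)) (L : R) :
  (forall sigma, separable sigma -> 0 <= expval W sigma) ->
  0 < L -> lipnorm W <= L -> density rho -> - L <= expval W rho.
Proof.
move=> hW L0 WL hrho.
have hs s : expval W ((sign_mx s *t 1%:M) *m rho *m (sign_mx s *t 1%:M)) - L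
            <= expval W rho.
  apply: expval_conj_unitary => //.
  - by rewrite adjmx_tens sign_mx_adj adjmx1.
  - by rewrite tensmx_mul sign_mx_sqr mulmx1 tensmx_scalar.
  (* A sign matrix is unitary, so it lies in the unit ball over which [lipnorm] takes its
     supremum. *)
  - apply: le_trans (opnorm_comm_le_lipnorm _ _) WL; apply: opnorm_isometry.
    by rewrite sign_mx_adj sign_mx_sqr.
have : \sum_s (expval W ((sign_mx s *t 1%:M) *m rho *m (sign_mx s *t 1%:M)) - L)
       <= \sum_(s : {ffun 'I_dA -> bool}) expval W rho.
  by apply: ler_sum => s _; apply: hs.
(* The conjugates add up to [N] times [dephase rho], with [N] the number of sign patterns; the
   factor [N > 0] is cancelled at the end. *)
rewrite big_split /= -expval_sumr sum_sign_conj scaler_nat expvalMn !sumr_const.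
have := hW _ (dephase_separable hrho).
rewrite -mulrnDl => h; have N0 : (0 < #|{ffun 'I_dA -> bool}|)%N.
  by apply/card_gt0P; exists [ffun=> true].
rewrite lerMn2r gtn_eqF //=; lra.
Qed.

(** There is only one block. *)
Lemma dephase_id rho : dA = 1%N -> dephase rho = rho.
Proof.
move=> d1; apply/matrixP => x y; case: (mxtens_indexP x) => i a; case: (mxtens_indexP y) => k b.
have val0 (j : 'I_dA) : val j = 0%N.
  by apply/eqP; rewrite -leqn0 -ltnS; apply: leq_trans (ltn_ord j) _; rewrite d1.
rewrite dephaseE; have -> : i = k by apply: val_inj; rewrite !val0.
by rewrite eqxx mul1r.
Qed.
End Dephasing.

(** * Lower bound on the cost *)

Section Completeness.
Context {R : realType}.
Local Notation C := R[i].

(* The [d ^ 2 - 1] matrices [F a], completed by [1 / sqrt d], are the rows of a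
   square matrix with orthonormal rows, hence also with orthonormal columns. *)
Lemma orthonormal_completeness d (F : 'I_(d ^ 2 - 1) -> 'M[C]_d) :
  (0 < d)%N -> traceless_orthonormal F -> forall i j k l,
  \sum_a F a j i * F a k l = (i == k)%:R * (j == l)%:R - (i == j)%:R * (k == l)%:R / d%:R.
Proof.
move=> d0 [hF tF oF _] i j k l.
have Fherm a x y : (F a x y)^* = F a y x.
  by have /hermsymmxP/matrixP/(_ y x) := hF a; rewrite adjmxE.
have dn0 : d%:R != 0 :> C by rewrite pnatr_eq0 -lt0n.
(* Chosen so that [s 1] has Hilbert-Schmidt norm 1. *)
pose s : C := sqrtC d%:R^-1.
have s2 : s * s = d%:R^-1 by rewrite -expr2 sqrtCK.
have sc : s^* = s by rewrite conj_Creal // ger0_real // sqrtC_ge0 invr_ge0 ler0n.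
pose G : 'M[C]_((d ^ 2 - 1) + 1, d * d) :=
  col_mx (\matrix_(a < d ^ 2 - 1) mxvec (F a)) (mxvec (s%:M)).
(* Vectorisation carries the Hilbert-Schmidt inner product to the standard one. *)
have dotE (A B : 'M[C]_d) : mxvec A *m adjmx (mxvec B) = (\tr (A *m adjmx B))%:M.
  apply/rowP => z; rewrite ord1 !mxE eqxx mulr1n.
  rewrite /mxtrace (reindex _ (curry_mxvec_bij _ _)) /=.
  under [RHS]eq_bigr => x _ do rewrite mxE.
  rewrite pair_bigA /=; apply: eq_bigr => -[x y] _ /=.
  by rewrite !adjmxE !mxvecE.
have hermF a : adjmx (F a) = F a by apply/hermsymmxP.
have adjs : adjmx (s%:M : 'M_d) = s%:M.
  apply/matrixP => x y; rewrite adjmxE !mxE eq_sym.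
  by case: eqVneq; rewrite ?mulr0n ?conjC0 ?mulr1n.
(* The four blocks express orthonormality of [F], its tracelessness twice, and the normalisation of
   [s 1]. *)
have GG : G *m adjmx G = 1%:M.
  rewrite /G /adjmx map_col_mx tr_col_mx mul_col_row -/(adjmx _) -/(adjmx _).
  rewrite -[RHS]submxK scalar_mx_block block_mxKul block_mxKur block_mxKdl block_mxKdr.
  congr block_mx.
  - apply/matrixP => a b; rewrite [RHS]mxE -oF -(hermF b).
    have := dotE (F a) (F b); move=> /matrixP /(_ 0 0); rewrite [RHS]mxE mulr1n => <-.
    rewrite !mxE; apply: eq_bigr => z _; rewrite !mxE //.
  - apply/matrixP => a b; rewrite [RHS]mxE ord1.
    have := dotE (F a) (s%:M); move=> /matrixP /(_ 0 0); rewrite [RHS]mxE mulr1n.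
    rewrite adjs mul_mx_scalar mxtraceZ tF mulr0 => <-.
    by rewrite !mxE; apply: eq_bigr => z _; rewrite !mxE.
  - apply/matrixP => a b; rewrite [RHS]mxE !ord1.
    have := dotE (s%:M) (F b); move=> /matrixP /(_ 0 0); rewrite [RHS]mxE mulr1n.
    rewrite hermF mul_scalar_mx mxtraceZ tF mulr0 => <-.
    by rewrite !mxE; apply: eq_bigr => z _; rewrite !mxE.
  - rewrite dotE adjs -scalar_mxM s2 mxtrace_scalar -[_ *+ _]mulr_natr mulVf //.
(* [G] is square only up to [d ^ 2 - 1 + 1 = d * d], which needs [d > 0] because the subtraction is
   truncated. Full rank then allows [G] to be cancelled on the left. *)
have Gfull : row_full G.
  have : row_free G by apply/row_freeP; exists (adjmx G).
  rewrite /row_free /row_full => /eqP ->.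
  by rewrite subnK ?mulnn // expn_gt0 d0.
have GG' : adjmx G *m G = 1%:M.
  by apply: (row_full_inj Gfull); rewrite mulmxA GG mul1mx mulmx1.
(* The relation is this entry of [G^* G = 1]; conjugation turns [F a i j] into [F a j i]. *)
have := congr1 (fun M : 'M_(d * d) => M (mxvec_index i j) (mxvec_index k l)) GG'.
rewrite mxE big_split_ord /= big_ord1.
under eq_bigr => a _.
  rewrite adjmxE !col_mxEu !mxE !mxvecE Fherm; over.
rewrite adjmxE !col_mxEd !mxvecE !mxE.
have -> : (mxvec_index i j == mxvec_index k l) = (i == k) && (j == l).
  apply/eqP/andP => [h|[/eqP -> /eqP ->]] //.
  have [g gK _] := curry_mxvec_bij d d.
  have /= ij := gK (i, j) isT; have /= kl := gK (k, l) isT.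
  by move: (congr1 g h); rewrite ij kl => -[-> ->].
have ee (b : bool) : (s *+ b)^* = s *+ b by case: b; rewrite ?mulr0n ?conjC0 ?mulr1n.
rewrite ee -mulnb natrM => h; apply/eqP; rewrite eq_sym subr_eq -h; apply/eqP.
congr (_ + _); rewrite -!(mulr_natr s) -s2; ring.
Qed.

End Completeness.

(** [X (x) 1] and [1 (x) X] commute, with product [X (x) X]. *)
Lemma sqr_tens_diff (K : comPzRingType) n (X : 'M[K]_n) :
  (X *t (1%:M : 'M_n) - (1%:M : 'M_n) *t X) ^+ 2 =
  (X *m X) *t 1%:M + 1%:M *t (X *m X) - 2 *: (X *t X).
Proof.
rewrite expr2 -mulmxE mulmxBl !mulmxBr !tensmx_mul !mul1mx !mulmx1.
rewrite scaler_nat mulr2n !opprD opprK !addrA.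
by rewrite [LHS]addrC !addrA [_ + (X *m X) *t _]addrC.
Qed.

Lemma scalar_mx_collect (K : comPzRingType) n (a b : K) (S : 'M[K]_n) :
  a%:M + a%:M - 2 *: (S - b%:M) = (2 * (a + b))%:M - 2 *: S.
Proof.
apply/matrixP => i j; rewrite !mxE.
by case: (i == j); rewrite ?mulr1n ?mulr0n; ring.
Qed.

Lemma scalar_mx_shift (K : comPzRingType) n (a : K) (S : 'M[K]_n) :
  a%:M - 2 *: S = (a - 2)%:M + 2 *: (1%:M - S).
Proof.
apply/matrixP => i j; rewrite !mxE.
by case: (i == j); rewrite ?mulr1n ?mulr0n; ring.
Qed.

(** * The swap of the A factors of two copies *)

Section Swap.
Context {R : realType}.
Variables dA dB : nat.
Local Notation C := R[i].
Local Notation N := ((dA * dB) * (dA * dB))%N.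

(** Defined on basis indices, so that the swap is a permutation matrix and its being a self-adjoint
    involution follows from that of the index map. *)
Definition swap_index (x : 'I_N) : 'I_N :=
  let: (x1, x2) := mxtens_unindex x in
  let: (i, a) := mxtens_unindex x1 in
  let: (j, b) := mxtens_unindex x2 in
  mxtens_index (mxtens_index (j, a), mxtens_index (i, b)).

Lemma swap_indexE (i j : 'I_dA) (a b : 'I_dB) :
  swap_index (mxtens_index (mxtens_index (i, a), mxtens_index (j, b))) =
  mxtens_index (mxtens_index (j, a), mxtens_index (i, b)).
Proof. by rewrite /swap_index !mxtens_indexK. Qed.

Lemma swap_indexK : involutive swap_index.
Proof.
move=> x; case: (mxtens_indexP x) => x1 x2.
case: (mxtens_indexP x1) => i a; case: (mxtens_indexP x2) => j b.
by rewrite !swap_indexE.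
Qed.

Definition swap_perm : 'S_N := perm (inv_inj swap_indexK).

Definition swapA : 'M[C]_N := perm_mx swap_perm.

Lemma swap_perm_sqr : (swap_perm * swap_perm)%g = 1%g.
Proof. by apply/permP => x; rewrite permM perm1 !permE swap_indexK. Qed.

Lemma swapA_sqr : swapA *m swapA = 1%:M.
Proof. by rewrite -perm_mxM swap_perm_sqr perm_mx1. Qed.

Lemma swapA_adj : adjmx swapA = swapA.
Proof.
rewrite /adjmx map_perm_mx tr_perm_mx; congr perm_mx.
by apply: (mulIg swap_perm); rewrite mulVg swap_perm_sqr.
Qed.

(** Entrywise the completeness relation: its first product of deltas is the swap, its second the
    identity. *)
Lemma sum_tens_swapA (F : 'I_(dA ^ 2 - 1) -> 'M[C]_dA) :
  (0 < dA)%N -> traceless_orthonormal F ->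
  \sum_a (F a *t (1%:M : 'M_dB)) *t (F a *t (1%:M : 'M_dB)) = swapA - (dA%:R^-1)%:M.
Proof.
move=> d0 hF; apply/matrixP => x y.
case: (mxtens_indexP x) => x1 x2; case: (mxtens_indexP y) => y1 y2.
case: (mxtens_indexP x1) => i a; case: (mxtens_indexP x2) => j b.
case: (mxtens_indexP y1) => k c; case: (mxtens_indexP y2) => l d.
rewrite summxE; under eq_bigr => m _.
  rewrite !tensmxE [X in _ * X * _]mxE [X in _ * (_ * X)]mxE mulrACA; over.
rewrite -mulr_suml (orthonormal_completeness d0 hF) !mxE permE swap_indexE.
rewrite !(inj_eq (can_inj (@mxtens_indexK _ _))) !xpair_eqE.
rewrite !(inj_eq (can_inj (@mxtens_indexK _ _))) !xpair_eqE.
rewrite [k == j]eq_sym [k == i]eq_sym.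
rewrite -[_^-1 *+ _]mulr_natr -!mulnb !natrM; ring.
Qed.

(** The completeness relation contracted over the inner index of the matrix product; this is a
    quadratic Casimir element. *)
Lemma sum_sqr_orthonormal (F : 'I_(dA ^ 2 - 1) -> 'M[C]_dA) :
  (0 < dA)%N -> traceless_orthonormal F ->
  \sum_a F a *m F a = (dA%:R - dA%:R^-1)%:M.
Proof.
move=> d0 hF; apply/matrixP => i j; rewrite summxE.
under eq_bigr do rewrite mxE.
rewrite exchange_big /=.
under eq_bigr do rewrite (orthonormal_completeness d0 hF) eqxx mul1r.
rewrite sumrB sumr_const card_ord mxE.
rewrite (bigD1 i) //= big1 => [|k ki]; last by rewrite (negbTE ki) !mul0r.
rewrite eqxx mul1r addr0.
case: (i == j); rewrite ?mulr1n ?mulr0n ?mul1r ?mul0r ?mul0rn ?subr0 //.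
Qed.

(** With [d = dA] and [S] the swap, the sum is [2 (d - 1/d) - 2 (S - 1/d)], where the terms in [1/d]
    cancel. *)
Lemma sum_cost_A (F : 'I_(dA ^ 2 - 1) -> 'M[C]_dA) :
  (0 < dA)%N -> traceless_orthonormal F ->
  \sum_a ((F a *t (1%:M : 'M_dB)) *t (1%:M : 'M_(dA * dB)) -
          (1%:M : 'M_(dA * dB)) *t (F a *t (1%:M : 'M_dB))) ^+ 2
  = (2 * dA%:R)%:M - 2 *: swapA.
Proof.
move=> d0 hF; pose X a := F a *t (1%:M : 'M[C]_dB).
rewrite (eq_bigr _ (fun a _ => sqr_tens_diff (X a))) sumrB big_split /= -scaler_sumr.
have sX : \sum_a X a *m X a = (dA%:R - dA%:R^-1)%:M.
  rewrite -[RHS](tensmx_scalar dA dB) -(sum_sqr_orthonormal d0 hF) tensmx_suml.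
  by apply: eq_bigr => a _; rewrite tensmx_mul mulmx1.
rewrite -tensmx_suml -tensmx_sumr sX tensmx_scalar tensmx_scalar_r.
have eS : \sum_a X a *t X a = swapA - (dA%:R^-1)%:M := sum_tens_swapA d0 hF.
by rewrite eS scalar_mx_collect; congr (_%:M - _); ring.
Qed.

Lemma expvalDl n (A B rho : 'M[C]_n) : expval (A + B) rho = expval A rho + expval B rho.
Proof. by rewrite /expval mulmxDl mxtraceD (raddfD (@complex.Re R)). Qed.

Lemma expval_suml n (I : eqType) (r : seq I) (F : I -> 'M[C]_n) rho :
  expval (\sum_(i <- r) F i) rho = \sum_(i <- r) expval (F i) rho.
Proof. by rewrite /expval mulmx_suml (raddf_sum mxtrace) raddf_sum. Qed.

Lemma expval_sqr_diff_ge0 n (X : 'M[C]_n) tau : adjmx X = X -> density tau ->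
  0 <= expval ((X *t (1%:M : 'M_n) - (1%:M : 'M_n) *t X) ^+ 2) tau.
Proof.
move=> hX [_ ht _]; rewrite expr2 -mulmxE; apply: expval_sqr_ge0 ht.
by rewrite adjmxD adjmxN !adjmx_tens hX adjmx1.
Qed.

(** As [S] is a self-adjoint involution, [2 (1 - S) = (1 - S)^2] has nonnegative expectation. *)
Lemma swapA_gap tau : density tau -> 2 * (dA%:R - 1) <=
  expval ((2 * dA%:R)%:M - 2 *: swapA) tau.
Proof.
move=> [_ ht t1].
have h : (1%:M - swapA) *m (1%:M - swapA) = 2 *: (1%:M - swapA).
  rewrite mulmxBr mulmx1 mulmxBl mul1mx swapA_sqr scaler_nat mulr2n.
  by rewrite opprB.
have := @expval_sqr_ge0 _ _ (1%:M - swapA) tau _ ht.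
rewrite adjmxD adjmxN adjmx1 swapA_adj h => /(_ erefl) ge0.
have -> : (2 * dA%:R)%:M - 2 *: swapA = (2 * (dA%:R - 1))%:M + 2 *: (1%:M - swapA).
  by rewrite scalar_mx_shift; congr (_%:M + _); ring.
rewrite expvalDl; apply: (@le_trans _ _ (expval (2 * (dA%:R - 1))%:M tau)); last by rewrite lerDl.
rewrite /expval mul_scalar_mx mxtraceZ t1 mulr1.
suff -> : 2 * (dA%:R - 1) = ((2 * (dA%:R - 1) : R)%:C)%C by [].
by rewrite rmorphM rmorphB !rmorph_nat rmorph1.
Qed.

(** The A terms give the swap bound; the B terms are squares of self-adjoint operators and only
    increase the cost. *)
Lemma cost_ge FA FB (tau : 'M[C]_N) :
  (0 < dA)%N -> traceless_orthonormal FA -> traceless_orthonormal FB ->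
  density tau -> 2 * (dA%:R - 1) <= expval (@cost R dA dB FA FB) tau.
Proof.
move=> d0 hFA hFB ht; rewrite /cost /K0 big_cat big_map big_enum big_map big_enum /= expvalDl.
rewrite sum_cost_A //; apply: le_trans (swapA_gap ht) _.
rewrite lerDl expval_suml; apply: sumr_ge0 => j _.
apply: expval_sqr_diff_ge0 ht; rewrite adjmx_tens adjmx1.
by have [/(_ j)/hermsymmxP -> _ _ _] := hFB.
Qed.

End Swap.

(** * From the cost to the entanglement measure *)

Section Measure.
Context {R : realType}.
Variables (dA dB : nat) (FA : 'I_(dA ^ 2 - 1) -> 'M[R[i]]_dA)
  (FB : 'I_(dB ^ 2 - 1) -> 'M[R[i]]_dB).

(** The state [sigma0] makes the infimum one over a nonempty set. *)
Lemma ent_measure_ge (rho sigma0 : 'M[R[i]]_(dA * dB)) (c : R) :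
  separable sigma0 ->
  (forall sigma, separable sigma -> c <= W1 FA FB rho sigma) ->
  c <= ent_measure FA FB rho.
Proof.
move=> h0 h; apply: lb_le_inf; first by exists (W1 FA FB rho sigma0), sigma0.
by move=> _ [sigma hs <-]; apply: h.
Qed.

Lemma W1_ge1 (rho sigma : 'M[R[i]]_(dA * dB)) : (1 < dA)%N ->
  traceless_orthonormal FA -> traceless_orthonormal FB ->
  density rho -> density sigma -> 1 <= W1 FA FB rho sigma.
Proof.
move=> d1 hFA hFB hr hs; rewrite -sqrtr1; apply: ler_wsqrtr; apply: lb_le_inf.
  by exists (expval (cost FA FB) (rho *t sigma)), (rho *t sigma); first exact: couplings_tens.
move=> _ [tau [ht _ _] <-]; apply: le_trans (cost_ge (ltnW d1) hFA hFB ht).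
have : 2 <= dA%:R :> R by rewrite ler_nat.
lra.
Qed.

End Measure.

Theorem theorem9 (R : realType) (dA dB : nat)
    (FA : 'I_(dA ^ 2 - 1) -> 'M[R[i]]_dA)
    (FB : 'I_(dB ^ 2 - 1) -> 'M[R[i]]_dB)
    (hFA : traceless_orthonormal FA)
    (hFB : traceless_orthonormal FB)
    (W : 'M[R[i]]_(dA * dB)) (hW : normalised_witness W)
    (L : R) (hL : 0 < L) (hLip : lipnorm W <= L)
    (rho : 'M[R[i]]_(dA * dB)) (hrho : density rho) :
  - expval W rho / L <= ent_measure FA FB rho /\
  (forall eps : R, 0 < eps -> expval W rho = - eps ->
    eps / L <= ent_measure FA FB rho).
Proof.
suff main : - expval W rho / L <= ent_measure FA FB rho.
  by split=> // eps _ e; rewrite -[eps]opprK -e.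
have [_ W0 [sigma0 h0 _]] := hW.
apply: (ent_measure_ge h0) => sigma hs; rewrite ler_pdivrMr //.
have := density_gt0 hrho; rewrite muln_gt0 => /andP [dA0 _].
case: (ltngtP dA 1) => [|d1|d1]; first by rewrite ltnNge dA0.
  (* Here [- Tr (W rho) <= L <= L * W1]. *)
  have := expval_ge_opp_lip W0 hL hLip hrho.
  have := W1_ge1 d1 hFA hFB hrho (separable_density hs).
  nra.
(* For [dA = 1] the state [rho] is its own dephasing, hence separable, and the bound only needs
   [W1 >= 0]. *)
have := W0 _ (dephase_separable hrho); rewrite (dephase_id _ d1) => ge0.
have := sqrtr_ge0 (inf [set expval (cost FA FB) tau | tau in couplings rho sigma])%classic.
rewrite -/(W1 FA FB rho sigma); nra.
Qed.
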